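(* Let $r\ge2$, let $\rho_1,\ldots,\rho_r,\sigma_1,\ldots,\sigma_r$ be quantum states on a common space, and let $\varepsilon\ge0$ be such that $\frac1r\sum_{i=1}^rd_B(\rho_i,\sigma_i)\le\varepsilon$. Then $$\left|F_S(\rho_1,\ldots,\rho_r)-F_S(\sigma_1,\ldots,\sigma_r)\right|\le2\sqrt2\left(\frac{r}{r-1}\right)\varepsilon.$$
   Context: A quantum state is a positive semi-definite operator of unit trace on a finite-dimensional complex Hilbert space. $F(\rho,\sigma)=\|\sqrt\rho\sqrt\sigma\|_1$ is the Uhlmann fidelity and $d_B(\rho,\sigma)=\sqrt{2[1-F(\rho,\sigma)]}$ the Bures distance. The secrecy measure is $S(\rho_1,\ldots,\rho_r)=\sup_{\sigma}\frac1r\sum_{i=1}^rF(\rho_i,\sigma)$ (supremum over all states $\sigma$ on the same space) and the secrecy-based multivariate fidelity is $F_S(\rho_1,\ldots,\rho_r)=\frac{1}{r-1}\left(r\,S(\rho_1,\ldots,\rho_r)^2-1\right)$. *)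

(* Defs.v *)
From HB Require Import structures.
From mathcomp Require Import all_boot all_order all_algebra.
From mathcomp Require Import spectral sesquilinear complex.
From mathcomp Require Import boolp classical_sets reals.

Set Implicit Arguments.
Unset Strict Implicit.
Unset Printing Implicit Defensive.

Import Order.TTheory GRing.Theory Num.Theory.
Local Open Scope ring_scope.
Local Open Scope sesquilinear_scope.

(* Operators on a d-dimensional complex Hilbert space are d x d matrices in an
   orthonormal basis; [A ^t*] is the adjoint. *)

(* In a [numClosedFieldType], [0 <= z] means that z is real and nonnegative. *)
Definition psdmx (C : numClosedFieldType) (d : nat) (A : 'M[C]_d) : Prop :=
  A \is hermsymmx /\ forall v : 'cV[C]_d, 0 <= (v ^t* *m A *m v) 0 0.

(* Functional calculus: [A = invmx P *m diag_mx D *m P] with [P := spectralmx A]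
   unitary and [D := spectral_diag A] when A is normal (this is the square root
   only for psd A; see [sqrtmxP]). *)
Definition sqrtmx (C : numClosedFieldType) (d : nat) (A : 'M[C]_d) : 'M[C]_d :=
  invmx (spectralmx A) *m diag_mx (map_mx sqrtC (spectral_diag A))
    *m spectralmx A.

Lemma psdmx_spectral_ge0 (C : numClosedFieldType) (d : nat) (A : 'M[C]_d) :
  psdmx A -> forall i, 0 <= spectral_diag A 0 i.
Proof.
move=> [hA pA] i.
have /orthomx_spectralP eA := hermitian_normalmx hA.
have uP := spectral_unitarymx A; have uu := spectral_unit A.
move: eA uP uu.
set P := spectralmx A; set D := spectral_diag A => eA uP uu.
have := pA (invmx P *m delta_mx i 0).
have -> : (invmx P *m delta_mx i 0) ^t* = (delta_mx 0 i : 'rV[C]_d) *m P.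
  rewrite invmx_unitary // trmx_mul map_mxM /= trmxCK; congr (_ *m _).
  by rewrite trmx_delta map_delta_mx.
rewrite {1}eA !mulmxA mulmxK // mulmxK // -rowE row_diag_mx -scalemxAl mxE.
by rewrite mul_delta_mx mxE !eqxx mulr1.
Qed.

Lemma sqrtmxP (C : numClosedFieldType) (d : nat) (A : 'M[C]_d) :
  psdmx A -> psdmx (sqrtmx A) /\ sqrtmx A *m sqrtmx A = A.
Proof.
move=> pA; have D_ge0 := psdmx_spectral_ge0 pA.
have /orthomx_spectralP eA := hermitian_normalmx pA.1.
have uP := spectral_unitarymx A; have uu := spectral_unit A.
rewrite /sqrtmx; move: eA uP uu D_ge0.
set P := spectralmx A; set D := spectral_diag A => eA uP uu D_ge0.
have s_ge0 i : 0 <= map_mx sqrtC D 0 i by rewrite mxE sqrtC_ge0.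
split; last first.
  rewrite [RHS]eA !mulmxA mulmxK // -(mulmxA _ (diag_mx _) (diag_mx _)) mulmx_diag.
  congr (_ *m diag_mx _ *m _); apply/rowP => i.
  by rewrite !mxE -expr2 sqrtCK.
rewrite invmx_unitary //; split.
  apply/is_hermitianmxP; rewrite /= expr0 scale1r.
  rewrite !trmx_mul !map_mxM /= trmxCK mulmxA tr_diag_mx map_diag_mx.
  congr (_ *m diag_mx _ *m _); apply/rowP => i.
  by rewrite !mxE; apply/esym/geC0_conj; rewrite sqrtC_ge0.
move=> v; set w := P *m v.
rewrite !mulmxA -[v ^t* *m _](_ : w ^t* = _); last first.
  by rewrite /w trmx_mul map_mxM.
rewrite -mulmxA -/w mul_mx_diag mxE sumr_ge0 // => i _.
by rewrite !mxE mulrAC mulr_ge0 // ?sqrtC_ge0 // mulrC mul_conjC_ge0.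
Qed.

Section QuantumStates.
Variables (R : realType) (d : nat).
Implicit Types A rho sigma : 'M[R[i]]_d.

Definition qstate : set 'M[R[i]]_d :=
  [set rho | psdmx rho /\ \tr rho = 1]%classic.

(* The trace is a nonnegative real, so [Re] only changes its type. *)
Definition trnorm A : R := complex.Re (\tr (sqrtmx (A ^t* *m A))).

Definition fidelity rho sigma : R := trnorm (sqrtmx rho *m sqrtmx sigma).

Definition bures rho sigma : R := Num.sqrt (2 * (1 - fidelity rho sigma)).

Definition secrecy (r : nat) (rho : 'I_r -> 'M[R[i]]_d) : R :=
  sup [set r%:R^-1 * \sum_(i < r) fidelity (rho i) sigma
      | sigma in qstate]%classic.

Definition secrecy_fidelity (r : nat) (rho : 'I_r -> 'M[R[i]]_d) : R :=
  (r%:R - 1)^-1 * (r%:R * secrecy rho ^+ 2 - 1).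

End QuantumStates.

(* Main.v *)
(* Write A, B, T for the square roots of rho, sigma, tau. The trace norm of M is
   the maximum of Re tr (M K) over contractions K, attained at the partial
   isometry of a polar decomposition. Choosing K for T A and W for A B,
     ||T A||_1 - ||T B||_1 <= Re tr (T (A - B W) K) <= ||A - B W||_2
                           <= sqrt (2 - 2 Re tr (A B W)) = d_B (rho, sigma),
   so the fidelity is 1-Lipschitz for the Bures distance in each argument.
   Taking suprema, |S - S'| <= eps, and S, S' lie in [0, 1], so
   |S^2 - S'^2| <= 2 eps; the factor sqrt 2 of the statement is slack. *)
Require Import Defs.
From mathcomp Require Import all_boot all_order all_algebra complex.
From mathcomp Require Import spectral sesquilinear ring lra.
From mathcomp Require Import classical_sets reals.

Import Order.TTheory GRing.Theory Num.Theory.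
Local Open Scope ring_scope.
Local Open Scope sesquilinear_scope.

(** * Adjoints and Gram matrices *)

Lemma adjmxM {C : numClosedFieldType} {m n p} (A : 'M[C]_(m, n))
    (B : 'M[C]_(n, p)) :
  (A *m B)^t* = B^t* *m A^t*.
Proof. by rewrite trmx_mul map_mxM. Qed.

Lemma psdmx_adj {C : numClosedFieldType} {n} (A : 'M[C]_n) :
  psdmx A -> A^t* = A.
Proof.
by case=> /is_hermitianmxP hA _; rewrite [in RHS]hA /= expr0 scale1r.
Qed.

Lemma psdmx_gram {C : numClosedFieldType} {m n} (M : 'M[C]_(m, n)) :
  psdmx (M^t* *m M).
Proof.
split; first by apply/is_hermitianmxP; rewrite /= expr0 scale1r adjmxM trmxCK.
move=> v; rewrite mulmxA -adjmxM -mulmxA mxE sumr_ge0 // => i _.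
by rewrite !mxE mulrC mul_conjC_ge0.
Qed.

(** * Real Hilbert-Schmidt geometry of complex matrices *)

Section HilbertSchmidt.
Context {R : realType}.
Local Notation C := R[i].
Local Notation Re := (@complex.Re R).

Lemma ReD (x y : C) : Re (x + y) = Re x + Re y.
Proof. by case: x y => [? ?] []. Qed.

Lemma ReN (x : C) : Re (- x) = - Re x.
Proof. by case: x. Qed.

Lemma Re_conj (x : C) : Re (x^*) = Re x.
Proof. by case: x. Qed.

Lemma Re_realM (t : R) (x : C) : Re (t%:C%C * x) = t * Re x.
Proof. by case: x => a b /=; rewrite mul0r subr0. Qed.

Lemma Re_sum {I : finType} (F : I -> C) : Re (\sum_i F i) = \sum_i Re (F i).
Proof. exact: (big_morph Re ReD). Qed.

Lemma Re_ge0 (x : C) : 0 <= x -> 0 <= Re x.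
Proof. by rewrite lecE => /andP[]. Qed.

(** The real part of the Hilbert-Schmidt inner product, with values in [R] so that bounds and square
    roots stay real. *)
Definition hsdot {m n} (X Y : 'M[C]_(m, n)) : R := Re (\tr (X *m Y^t*)).

Lemma hsdotC {m n} (X Y : 'M[C]_(m, n)) : hsdot X Y = hsdot Y X.
Proof.
rewrite /hsdot -[Y in RHS]trmxCK -adjmxM trace_map_mx mxtrace_tr.
by rewrite Re_conj.
Qed.

Lemma hsdotBl {m n} (X Y Z : 'M[C]_(m, n)) :
  hsdot (X - Y) Z = hsdot X Z - hsdot Y Z.
Proof. by rewrite /hsdot mulmxBl raddfB /= ReD ReN. Qed.

Lemma hsdotBr {m n} (X Y Z : 'M[C]_(m, n)) :
  hsdot Z (X - Y) = hsdot Z X - hsdot Z Y.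
Proof. by rewrite hsdotC hsdotBl !(hsdotC _ Z). Qed.

Lemma hsdotZl {m n} (t : R) (X Z : 'M[C]_(m, n)) :
  hsdot (t%:C%C *: X) Z = t * hsdot X Z.
Proof. by rewrite /hsdot -scalemxAl mxtraceZ Re_realM. Qed.

Lemma hsdotZr {m n} (t : R) (X Z : 'M[C]_(m, n)) :
  hsdot Z (t%:C%C *: X) = t * hsdot Z X.
Proof. by rewrite hsdotC hsdotZl hsdotC. Qed.

Lemma hsdot_ge0 {m n} (X : 'M[C]_(m, n)) : 0 <= hsdot X X.
Proof.
apply: Re_ge0; apply: sumr_ge0 => i _; rewrite mxE sumr_ge0 // => j _.
by rewrite !mxE mul_conjC_ge0.
Qed.

Lemma hsdot_mulmxr {m n p} (X : 'M[C]_(m, n)) (Y : 'M[C]_(n, p)) Z :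
  hsdot (X *m Y) Z = hsdot X (Z *m Y^t*).
Proof. by rewrite /hsdot adjmxM trmxCK mulmxA. Qed.

(** Lets estimates on row vectors, where contractions are tested, pass to matrices by summation. *)
Lemma hsdot_rows {m n} (X Y : 'M[C]_(m, n)) :
  hsdot X Y = \sum_i hsdot (row i X) (row i Y).
Proof.
rewrite /hsdot /mxtrace Re_sum; apply: eq_bigr => i _.
rewrite Re_sum big_ord1 !mxE; congr Re; apply: eq_bigr => j _.
by rewrite !mxE.
Qed.

Lemma discriminant_le (a b c : R) : 0 <= b ->
  (forall t s, 0 <= t ^+ 2 * a - 2 * t * s * c + s ^+ 2 * b) -> c ^+ 2 <= a * b.
Proof.
move=> b_ge0 q; have [b0|bN] := eqVneq b 0.
  (* For [b = 0] the points [(c, 1)] and [(c, a)] give [2 c^2 <= a c^2 <= 0]. *)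
  by have := q c 1; have := q c a; rewrite b0; lra.
have b_gt0 : 0 < b by rewrite lt_neqAle eq_sym bN.
(* The form at [(b, c)] equals [b (a b - c^2)]. *)
by rewrite -subr_ge0 -(pmulr_rge0 _ b_gt0); have := q b c; lra.
Qed.

Lemma CauchySchwarz_hsdot {m n} (X Y : 'M[C]_(m, n)) :
  hsdot X Y ^+ 2 <= hsdot X X * hsdot Y Y.
Proof.
apply: discriminant_le (hsdot_ge0 Y) _ => t s.
have := hsdot_ge0 (t%:C%C *: X - s%:C%C *: Y).
rewrite hsdotBl !hsdotBr !hsdotZl !hsdotZr (hsdotC Y X).
by move: (hsdot X X) (hsdot X Y) (hsdot Y Y) => a c b; lra.
Qed.

Lemma hsdot_le {m n} (X Y : 'M[C]_(m, n)) :
  hsdot X Y <= Num.sqrt (hsdot X X) * Num.sqrt (hsdot Y Y).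
Proof.
rewrite -sqrtrM ?hsdot_ge0 //; apply: le_trans (ler_norm _) _.
by rewrite -sqrtr_sqr ler_sqrt ?mulr_ge0 ?hsdot_ge0 ?CauchySchwarz_hsdot.
Qed.

(** * Contractions: operator norm at most 1, acting on rows from the right *)

Definition contraction {n} (K : 'M[C]_n) : Prop :=
  forall v : 'rV[C]_n, hsdot (v *m K) (v *m K) <= hsdot v v.

Lemma contraction_hsdot {m n} (X : 'M[C]_(m, n)) (K : 'M[C]_n) :
  contraction K -> hsdot (X *m K) (X *m K) <= hsdot X X.
Proof.
move=> cK; rewrite hsdot_rows (hsdot_rows X); apply: ler_sum => i _.
by rewrite row_mul.
Qed.

Lemma contractionM {n} (K L : 'M[C]_n) :
  contraction K -> contraction L -> contraction (K *m L).
Proof. by move=> cK cL v; rewrite mulmxA (le_trans (cL _)). Qed.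

(** With [w] the image of [v] under the adjoint, the squared norm of [w] is the inner product of [v]
    and [w *m K]; apply Cauchy-Schwarz and cancel one factor [hsdot w w]. *)
Lemma contraction_adj {n} (K : 'M[C]_n) : contraction K -> contraction (K^t*).
Proof.
move=> cK v; set w := v *m K^t*.
have h : hsdot w w ^+ 2 <= hsdot w w * hsdot v v.
  have {1}-> : hsdot w w = hsdot v (w *m K).
    by rewrite {1}/w hsdot_mulmxr trmxCK.
  apply: le_trans (CauchySchwarz_hsdot _ _) _.
  by rewrite mulrC ler_wpM2r ?hsdot_ge0 ?cK.
have [->|w0] := eqVneq (hsdot w w) 0; first exact: hsdot_ge0.
by rewrite expr2 ler_pM2l // lt_neqAle eq_sym w0 hsdot_ge0 in h.
Qed.

Lemma unitarymx_contraction {n} (U : 'M[C]_n) :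
  U \is unitarymx -> contraction U.
Proof. by move=> uU v; rewrite hsdot_mulmxr mulmxtVK ?lexx. Qed.

Lemma contraction_diag {n} (e : 'rV[C]_n) :
  (forall i, `|e 0 i| <= 1) -> contraction (diag_mx e).
Proof.
move=> e1 v; rewrite /hsdot /mxtrace !big_ord1 !mxE !Re_sum.
apply: ler_sum => i _; rewrite mul_mx_diag !mxE -!normCK normrM.
rewrite exprMn -[X in _ <= X]mulr1.
suff : `|v 0 i| ^+ 2 * `|e 0 i| ^+ 2 <= `|v 0 i| ^+ 2.
  by rewrite lecE mulr1 => /andP[].
by rewrite ler_piMr ?exprn_ge0 ?exprn_ile1.
Qed.

(** The squared norm of [v *m K] is the inner product of [v] with its image under [K *m K^t*], so
    Cauchy-Schwarz applies. *)
Lemma contraction_gram {n} (K : 'M[C]_n) :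
  contraction (K *m K^t*) -> contraction K.
Proof.
move=> cK v; rewrite hsdot_mulmxr -mulmxA.
apply: le_trans (hsdot_le _ _) _.
rewrite -[X in _ <= X]sqr_sqrtr; last exact: hsdot_ge0.
by rewrite ler_wpM2l ?sqrtr_ge0 // ler_sqrt ?hsdot_ge0 ?cK.
Qed.

Lemma Re_sqrtC (x : C) : 0 <= x -> Re (sqrtC x) = Num.sqrt (Re x).
Proof.
move=> x0; have y0 : 0 <= sqrtC x by rewrite sqrtC_ge0.
rewrite -[in RHS](sqrtCK x); case: (sqrtC x) y0 => a b.
rewrite lecE /= => /andP[/eqP -> a0].
by rewrite mulr0 subr0 -expr2 sqrtr_sqr ger0_norm.
Qed.

(** * The trace norm as a maximum over contractions *)

Section TraceNorm.
Context {d : nat}.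
Implicit Types (M K : 'M[C]_d).

Lemma gram_spectral M (P := spectralmx (M^t* *m M))
    (D := spectral_diag (M^t* *m M)) :
  M^t* *m M = P^t* *m diag_mx D *m P.
Proof.
have /orthomx_spectralP {1}-> := hermitian_normalmx (psdmx_gram M).1.
by rewrite invmx_unitary ?spectral_unitarymx.
Qed.

(** Cyclicity of the trace removes the eigenbasis and leaves the sum of the singular values. *)
Lemma trnormE M :
  trnorm M = \sum_i Re (sqrtC (spectral_diag (M^t* *m M) 0 i)).
Proof.
rewrite /trnorm /sqrtmx mxtrace_mulC mulmxA mulmxV ?spectral_unit // mul1mx.
by rewrite mxtrace_diag Re_sum; apply: eq_bigr => i _; rewrite mxE.
Qed.

Lemma trnorm_ge0 M : 0 <= trnorm M.
Proof.
rewrite trnormE sumr_ge0 // => i _; rewrite Re_ge0 // sqrtC_ge0.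
exact/psdmx_spectral_ge0/psdmx_gram.
Qed.

Lemma hsdot_row_gram {m n} (X : 'M[C]_(m, n)) i :
  hsdot (row i X) (row i X) = Re ((X *m X^t*) i i).
Proof.
rewrite /hsdot /mxtrace big_ord1 !mxE; congr Re; apply: eq_bigr => j _.
by rewrite !mxE.
Qed.

(** In an eigenbasis of [M^t* *m M], the images of the basis vectors under [M] have the singular
    values as norms, and the rows of [P *m K] have norm at most 1. Cauchy-Schwarz on each row then
    bounds the trace term by term. *)
Lemma trnorm_ge M K : contraction K -> Re (\tr (M *m K)) <= trnorm M.
Proof.
move=> cK; have eM := gram_spectral M.
have D0 := psdmx_spectral_ge0 (psdmx_gram M).
rewrite trnormE; have := spectral_unitarymx (M^t* *m M).
move: eM D0; set P := spectralmx _; set D := spectral_diag _ => eM D0 uP.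
set N := M *m P^t*.
have NN : N^t* *m N = diag_mx D.
  rewrite /N adjmxM trmxCK mulmxA -(mulmxA P) eM !mulmxA (unitarymxP uP).
  by rewrite mul1mx -mulmxA (unitarymxP uP) mulmx1.
have -> : Re (\tr (M *m K)) = hsdot (P *m K) (N^t*).
  by rewrite /hsdot trmxCK [in RHS]mxtrace_mulC /N mulmxA mulmxKtV.
rewrite hsdot_rows; apply: ler_sum => i _.
apply: le_trans (hsdot_le _ _) _.
rewrite (hsdot_row_gram (N^t*)) trmxCK NN mxE eqxx mulr1n Re_sqrtC //.
rewrite ler_piMl ?sqrtr_ge0 // -[X in _ <= X]sqrtr1 ler_sqrt // row_mul.
by rewrite (le_trans (cK _)) // hsdot_row_gram (unitarymxP uP) mxE eqxx.
Qed.

Lemma trnorm_attained M :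
  exists2 K, contraction K & Re (\tr (M *m K)) = trnorm M.
Proof.
have eM := gram_spectral M.
have D0 := psdmx_spectral_ge0 (psdmx_gram M).
rewrite trnormE; have := spectral_unitarymx (M^t* *m M).
move: eM D0; set P := spectralmx _; set D := spectral_diag _ => eM D0 uP.
(* [0^-1 = 0] makes [G] the pseudo-inverse of the modulus of [M]. *)
pose g : 'rV[C]_d := \row_i (sqrtC (D 0 i))^-1.
set G := P^t* *m diag_mx g *m P; exists (G *m M^t*).
  (* The product of the witness with its adjoint is diagonal in the eigenbasis [P], with entries 0
     where [D] vanishes and 1 elsewhere: an orthogonal projection. *)
  apply: contraction_gram.
  rewrite adjmxM trmxCK mulmxA -(mulmxA G) eM /G !adjmxM trmxCK.
  rewrite !mulmxA (mulmxtVK (P^t* *m diag_mx g) uP).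
  rewrite (mulmxtVK (P^t* *m diag_mx g *m diag_mx D) uP).
  apply/contractionM/unitarymx_contraction => //.
  rewrite -!mulmxA; apply/contractionM.
    by apply/unitarymx_contraction; rewrite trmxC_unitary.
  rewrite tr_diag_mx map_diag_mx mulmx_diag mulmx_diag.
  apply: contraction_diag => i; rewrite !mxE.
  have s0 : 0 <= sqrtC (D 0 i) by rewrite sqrtC_ge0.
  have [->|sN] := eqVneq (D 0 i) 0; first by rewrite mul0r mulr0 normr0.
  rewrite /= geC0_conj ?invr_ge0 // -{2}(sqrtCK (D 0 i)) expr2 -mulrA.
  rewrite mulfV ?sqrtC_eq0 //.
  by rewrite mulr1 mulVf ?sqrtC_eq0 // normr1.
(* By cyclicity this is the trace of [G] times [M^t* *m M], the sum of the [g_i D_i]; each term is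
   the square root of [D_i], also when [D_i = 0]. *)
rewrite mxtrace_mulC -(mulmxA G) eM /G !mulmxA (mulmxtVK _ uP).
rewrite mxtrace_mulC !mulmxA (unitarymxP uP) mul1mx mulmx_diag.
rewrite mxtrace_diag Re_sum.
apply: eq_bigr => i _; rewrite !mxE; congr Re.
have [->|sN] := eqVneq (D 0 i) 0; first by rewrite mulr0 sqrtC0.
by rewrite -{2}(sqrtCK (D 0 i)) expr2 mulKf ?sqrtC_eq0.
Qed.

Lemma Re_trace_adj M : Re (\tr (M^t*)) = Re (\tr M).
Proof. by rewrite trace_map_mx mxtrace_tr Re_conj. Qed.

(** The adjoint of a contraction optimal for [M^t*] is a competitor for [M] with the same real
    trace. *)
Lemma trnorm_adj_le M : trnorm (M^t*) <= trnorm M.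
Proof.
have [K cK <-] := trnorm_attained (M^t*).
rewrite -Re_trace_adj adjmxM trmxCK mxtrace_mulC.
exact/trnorm_ge/contraction_adj.
Qed.

Lemma trnorm_adj M : trnorm (M^t*) = trnorm M.
Proof.
apply/le_anti/andP; split; first exact: trnorm_adj_le.
by have := trnorm_adj_le (M^t*); rewrite trmxCK.
Qed.

Lemma trnorm_herm_mulC (A B : 'M[C]_d) :
  A^t* = A -> B^t* = B -> trnorm (A *m B) = trnorm (B *m A).
Proof. by move=> hA hB; rewrite -[LHS]trnorm_adj adjmxM hA hB. Qed.

Lemma trnorm_mul_le1 (A B : 'M[C]_d) :
  A^t* = A -> hsdot A A = 1 -> hsdot B B = 1 -> trnorm (A *m B) <= 1.
Proof.
move=> hA nA nB; have [K cK <-] := trnorm_attained (A *m B).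
have -> : Re (\tr (A *m B *m K)) = hsdot (B *m K) A.
  by rewrite /hsdot hA [in RHS]mxtrace_mulC mulmxA.
apply: le_trans (hsdot_le _ _) _; rewrite nA sqrtr1 mulr1 -[X in _ <= X]sqrtr1.
by rewrite ler_wsqrtr // -[X in _ <= X]nB contraction_hsdot.
Qed.

(** The Lipschitz estimate for the fidelity, with [A], [B], [T] in the role of square roots of
    states. *)
Lemma trnorm_mul_le (A B T : 'M[C]_d) :
  A^t* = A -> T^t* = T -> hsdot A A = 1 -> hsdot B B = 1 -> hsdot T T = 1 ->
  trnorm (T *m A)
    <= trnorm (T *m B) + Num.sqrt (2 * (1 - trnorm (A *m B))).
Proof.
(* Here [x] stands for the trace norm of [A *m B] and [y] for the squared norm of [B *m W]; the left
   side is the expanded squared norm of [A - B *m W]. *)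
have ineq (x y : R) : y <= 1 -> 1 - x - (x - y) <= 2 * (1 - x) by lra.
move=> hA hT nA nB nT.
have [K cK <-] := trnorm_attained (T *m A).
have [W cW eW] := trnorm_attained (A *m B).
(* [W *m K] need not be optimal for [T *m B], but it makes the two traces differ by the inner
   product of [(A - B *m W) *m K] and [T]. *)
have hW := trnorm_ge (T *m B) _ (contractionM _ _ cW cK).
rewrite -lerBlDl; apply: le_trans (lerB (lexx _) hW) _.
pose X := A - B *m W.
have -> : Re (\tr (T *m A *m K)) - Re (\tr (T *m B *m (W *m K)))
    = hsdot (X *m K) T.
  rewrite /hsdot hT [in RHS]mxtrace_mulC /X mulmxBl mulmxBr raddfB /= ReD ReN.
  by rewrite !mulmxA.
apply: le_trans (hsdot_le _ _) _; rewrite nT sqrtr1 mulr1 ler_wsqrtr //.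
apply: le_trans (contraction_hsdot _ _ cK) _.
rewrite /X hsdotBl !hsdotBr nA (hsdotC A).
have -> : hsdot (B *m W) A = trnorm (A *m B).
  by rewrite -eW /hsdot hA mxtrace_mulC mulmxA.
have := contraction_hsdot B _ cW; rewrite nB.
exact: ineq.
Qed.

End TraceNorm.

(** * Fidelity and Bures distance of states *)

Section Fidelity.
Context {d : nat}.
Implicit Types rho sigma tau : 'M[C]_d.

Lemma sqrtmx_adj rho : qstate rho -> (sqrtmx rho)^t* = sqrtmx rho.
Proof. by case=> /sqrtmxP[p _] _; apply: psdmx_adj. Qed.

(** States become unit vectors: the squared norm of the square root is the trace of [rho]. *)
Lemma hsdot_sqrtmx rho : qstate rho -> hsdot (sqrtmx rho) (sqrtmx rho) = 1.
Proof.
move=> q; rewrite /hsdot sqrtmx_adj //.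
by case: q => /sqrtmxP[_ ->] ->.
Qed.

Lemma fidelity_ge0 rho sigma : 0 <= fidelity rho sigma.
Proof. exact: trnorm_ge0. Qed.

Lemma fidelityC rho sigma :
  qstate rho -> qstate sigma -> fidelity rho sigma = fidelity sigma rho.
Proof.
by move=> qr qs; apply: trnorm_herm_mulC; apply: sqrtmx_adj.
Qed.

Lemma buresC rho sigma :
  qstate rho -> qstate sigma -> bures rho sigma = bures sigma rho.
Proof. by move=> qr qs; rewrite /bures fidelityC. Qed.

Lemma fidelity_le_bures rho sigma tau :
  qstate rho -> qstate sigma -> qstate tau ->
  fidelity tau rho <= fidelity tau sigma + bures rho sigma.
Proof.
by move=> qr qs qt; apply: trnorm_mul_le; first [apply: sqrtmx_adj
  | apply: hsdot_sqrtmx].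
Qed.

Lemma fidelity_le1 rho sigma :
  qstate rho -> qstate sigma -> fidelity rho sigma <= 1.
Proof.
by move=> qr qs; apply: trnorm_mul_le1; first [apply: sqrtmx_adj
  | apply: hsdot_sqrtmx].
Qed.

(** * The secrecy measure of a nonempty family of states *)

Section Secrecy.
Context {r : nat}.
Implicit Types (rhos sigmas : 'I_r.+1 -> 'M[C]_d).

Lemma mean_fidelity_le1 rhos sigma :
  (forall i, qstate (rhos i)) -> qstate sigma ->
  r.+1%:R^-1 * \sum_i fidelity (rhos i) sigma <= 1.
Proof.
move=> qr qs; rewrite mulrC ler_pdivrMr ?ltr0Sn // mul1r.
have -> : r.+1%:R = \sum_(i < r.+1) (1 : R) by rewrite sumr_const card_ord.
by apply: ler_sum => i _; apply: fidelity_le1.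
Qed.

Lemma mean_fidelity_le_secrecy rhos sigma :
  (forall i, qstate (rhos i)) -> qstate sigma ->
  r.+1%:R^-1 * \sum_i fidelity (rhos i) sigma <= secrecy rhos.
Proof.
move=> qr qs; apply: sup_upper_bound; last by exists sigma.
split; first by eexists; exists sigma.
(* Boundedness matters: [sup] of an unbounded set is only a default value. *)
by exists 1 => _ [tau qt <-]; apply: mean_fidelity_le1.
Qed.

Lemma secrecy_le rhos (x : R) : (forall i, qstate (rhos i)) ->
  (forall sigma, qstate sigma ->
    r.+1%:R^-1 * \sum_i fidelity (rhos i) sigma <= x) ->
  secrecy rhos <= x.
Proof.
move=> qr ub; apply: ge_sup; first by eexists; exists (rhos ord0).
by move=> _ [sigma qs <-]; apply: ub.
Qed.

Lemma secrecy_ge0 rhos : (forall i, qstate (rhos i)) -> 0 <= secrecy rhos.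
Proof.
move=> qr; apply: le_trans (mean_fidelity_le_secrecy _ _ qr (qr ord0)).
by rewrite mulr_ge0 ?invr_ge0 ?ler0n ?sumr_ge0 // => i _; apply: fidelity_ge0.
Qed.

Lemma secrecy_le1 rhos : (forall i, qstate (rhos i)) -> secrecy rhos <= 1.
Proof.
by move=> qr; apply: secrecy_le => // sigma; apply: mean_fidelity_le1.
Qed.

Lemma secrecy_le_bures rhos sigmas :
  (forall i, qstate (rhos i)) -> (forall i, qstate (sigmas i)) ->
  secrecy rhos <=
    secrecy sigmas + r.+1%:R^-1 * \sum_i bures (rhos i) (sigmas i).
Proof.
move=> qr qs; apply: secrecy_le => // tau qt.
(* Both families are compared at the same [tau], so the Lipschitz estimate can be averaged over
   [i]. *)
apply: le_trans (lerD (mean_fidelity_le_secrecy _ _ qs qt) (lexx _)).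
rewrite -mulrDr ler_wpM2l ?invr_ge0 ?ler0n // -big_split ler_sum //= => i _.
rewrite (fidelityC _ _ (qr i) qt) (fidelityC _ _ (qs i) qt).
exact: fidelity_le_bures.
Qed.

End Secrecy.
End Fidelity.
End HilbertSchmidt.

(** * From the secrecy measure to the multivariate fidelity *)

Theorem mainTheorem10 (R : realType) (d r : nat) (r_ge2 : (2 <= r)%N)
    (rho sigma : 'I_r -> 'M[R[i]]_d)
    (rho_state : forall i, qstate (rho i))
    (sigma_state : forall i, qstate (sigma i))
    (eps : R) (eps_ge0 : 0 <= eps)
    (hbures : r%:R^-1 * \sum_(i < r) bures (rho i) (sigma i) <= eps) :
  `|secrecy_fidelity rho - secrecy_fidelity sigma|
    <= 2 * Num.sqrt 2 * (r%:R / (r%:R - 1)) * eps.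
Proof.
(* From here on [r] is one less than the number of states, hence at least 1. *)
case: r r_ge2 rho sigma rho_state sigma_state hbures => // r r_ge1.
rewrite ltnS in r_ge1 => rho sigma qr qs hb.
have rs := le_trans (secrecy_le_bures _ _ qr qs) (lerD (lexx _) hb).
(* Symmetry of the Bures distance lets the same hypothesis bound the difference in the other
   direction. *)
rewrite (eq_bigr _ (fun i _ => buresC _ _ (qr i) (qs i))) in hb.
have sr := le_trans (secrecy_le_bures _ _ qs qr) (lerD (lexx _) hb).
have r0 := secrecy_ge0 _ qr; have r1 := secrecy_le1 _ qr.
have s0 := secrecy_ge0 _ qs; have s1 := secrecy_le1 _ qs.
rewrite /secrecy_fidelity; move: rs sr r0 r1 s0 s1.
move: (secrecy rho) (secrecy sigma) => S S' rs sr r0 r1 s0 s1.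
have d0 : 0 < r.+1%:R - 1 :> R by rewrite subr_gt0 ltr1n.
rewrite -mulrBr normrM gtr0_norm ?invr_gt0 // opprB addrA subrK -mulrBr normrM.
rewrite ger0_norm ?ler0n //.
have -> : 2 * Num.sqrt 2 * (r.+1%:R / (r.+1%:R - 1)) * eps =
   (r.+1%:R - 1)^-1 * (r.+1%:R * (2 * Num.sqrt 2 * eps)) :> R by ring.
rewrite ler_pM2l ?invr_gt0 // ler_pM2l ?ltr0Sn //.
have h : `|S - S'| <= eps by rewrite ler_distl lerBlDr; apply/andP.
have q2 : 1 <= Num.sqrt 2 :> R.
  by rewrite -[X in X <= _]sqrtr1 ler_wsqrtr ?ler1n.
(* The difference of squares is at most [eps] times a sum at most 2; the factor [Num.sqrt 2 >= 1]
   then only enlarges the bound. *)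
rewrite subr_sqr normrM (ger0_norm (addr_ge0 r0 s0)).
apply: le_trans (_ : eps * 2 <= _).
  by apply: ler_pM; rewrite ?normr_ge0 ?addr_ge0 //; lra.
by rewrite mulrC ler_wpM2r // ler_peMr.
Qed.
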